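(* Let $\mu_k>0$. For all integers $N>0$, $$\|(\mathcal{L}_k^{(N)})^{-1}\|_{B(\ell^1)}\le\max\{2\|T_k^{-1}\|_1,\,1\},$$ where the $1$ in the maximum comes from the fact that the first column of $(\mathcal{L}_k^{(N)})^{-1}$ has $\ell^1$ norm equal to $1$.
   Context: $\mu_k$ is a real number. $T_k$ is the $N\times N$ tridiagonal matrix with diagonal entries $(T_k)_{j,j}=2j$ ($1\le j\le N$), superdiagonal entries $-\mu_k$ and subdiagonal entries $\mu_k$. $\mathcal{L}_k^{(N)}$ is the $(N+1)\times(N+1)$ matrix whose first row is $(1,-2,2,-2,\dots,2(-1)^N)$, whose first column is $(1,\mu_k,0,\dots,0)^T$, and whose lower-right $N\times N$ block (rows and columns $2,\dots,N+1$) is $T_k$. Norms: for a vector $v=(v_1,\dots,v_{N+1})$, $\|v\|_{\ell^1}=|v_1|+2\sum_{j=2}^{N+1}|v_j|$; for an $(N+1)\times(N+1)$ matrix $A$ with entries $a_{j,n}$, $$\|A\|_{B(\ell^1)}=\max\left\{|a_{1,1}|+2\sum_{j=2}^{N+1}|a_{j,1}|,\ \sup_{n>1}\left(\tfrac12|a_{1,n}|+\sum_{j=2}^{N+1}|a_{j,n}|\right)\right\};$$ for an $N\times N$ matrix $A$, $\|A\|_1=\max_i\sum_{j=1}^N|A_{ij}|$. Both $T_k$ and $\mathcal{L}_k^{(N)}$ are invertible. *)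

(* Defs.v *)
From mathcomp Require Import all_boot all_order all_algebra.
From mathcomp Require Import reals.

Set Implicit Arguments.
Unset Strict Implicit.
Unset Printing Implicit Defensive.

Import Order.TTheory GRing.Theory Num.Theory.
Local Open Scope ring_scope.

(* Matrix indices start at 0 here: the index i : 'I_N stands for the row or
   column i + 1 of the usual 1-based numbering. *)

Definition Tmx (R : realType) (mu : R) (N : nat) : 'M[R]_N :=
  \matrix_(i < N, j < N)
    (if i == j then 2 * i.+1%:R
     else if i.+1 == j :> nat then - mu
     else if i == j.+1 :> nat then mu
     else 0).

Definition Lmx (R : realType) (mu : R) (N : nat) : 'M[R]_N.+1 :=
  block_mx (1%:M : 'M[R]_1) (\row_(j < N) (2 * (-1) ^+ j.+1))
           (\col_(i < N) (if i == 0 :> nat then mu else 0)) (Tmx mu N).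

Definition l1norm (R : realType) (N : nat) (v : 'cV[R]_N.+1) : R :=
  `|v ord0 0| + 2 * \sum_(j < N.+1 | j != ord0) `|v j 0|.

(* The maxima below run over nonnegative quantities, so starting them at 0
   only matters when the index set is empty, i.e. when N = 0. *)

Definition Bl1norm (R : realType) (N : nat) (A : 'M[R]_N.+1) : R :=
  Num.max
    (`|A ord0 ord0| + 2 * \sum_(j < N.+1 | j != ord0) `|A j ord0|)
    (\big[Num.max/0]_(n < N.+1 | n != ord0)
       (2^-1 * `|A ord0 n| + \sum_(j < N.+1 | j != ord0) `|A j n|)).

Definition mxnorm1 (R : realType) (N : nat) (A : 'M[R]_N) : R :=
  \big[Num.max/0]_(i < N) \sum_(j < N) `|A i j|.

(* Main.v *)
Require Import Defs.
From mathcomp Require Import all_boot all_order all_algebra.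
From mathcomp Require Import reals.
From mathcomp Require Import zify ring lra.

Import Order.TTheory GRing.Theory Num.Theory.
Local Open Scope ring_scope.

Set Implicit Arguments.
Unset Strict Implicit.

(** Write L for the bordered matrix, with border row r and border column c
    around T, and put x = T^-1 c.  Block elimination expresses L^-1 through
    T^-1 and the Schur complement s = 1 - r x.  Everything rests on the value
    of s: since c is supported on its first entry, the rows of T x = c give,
    for w_k = (-1)^k x_k, the backward recurrence
      mu w_(k-1) = 2 (k+1) w_k + mu w_(k+1)   (0-based indices),
    whose coefficients are positive, so the w_k all have the sign of the last
    one, and the first row rules out the negative sign.  The entries of r
    alternate in the same way, so no cancellation happens in r x and
      s = 1 + 2 sum_k |x_k|.
    The first column of L^-1 is (1, -x) / s, hence has norm exactly 1.
    The column of L^-1 that borders a column y of T^-1 is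
    (- r y / s, y + x (r y) / s); the triangle inequality and the value of s
    bound its weighted norm by sum |y_i| + |r y| / 2 <= 2 sum |y_i|.

    This controls the inverse by the column sums of |T^-1|, whereas the norm in
    the bound takes row sums.  The two agree because |T^-1| is symmetric:
    conjugation by the diagonal signs (-1)^i turns T into its transpose.
    Invertibility of T holds because its symmetric part is a positive diagonal
    matrix. *)

(** * Inverse of a bordered matrix *)

Lemma invmx_bordered (F : fieldType) (n : nat) (r : 'rV[F]_n) (c : 'cV[F]_n)
    (T : 'M[F]_n) (s := 1 - (r *m (invmx T *m c)) 0 0) :
  T \in unitmx -> s != 0 ->
  invmx (block_mx (1%:M : 'M_1) r c T) =
  block_mx s^-1%:M (- s^-1 *: (r *m invmx T))
           (- s^-1 *: (invmx T *m c))
           (invmx T + s^-1 *: (invmx T *m c *m (r *m invmx T))).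
Proof.
move=> Tu s0; set B := RHS; set A := block_mx _ _ _ _.
suff AB : A *m B = 1%:M.
  have [Au _] := mulmx1_unit AB.
  by rewrite -[RHS](mulKmx Au) AB mulmx1.
have rxE : r *m (invmx T *m c) = (1 - s)%:M.
  by rewrite [LHS]mx11_scalar /s opprB addrC subrK.
have TxE : T *m (invmx T *m c) = c by rewrite mulmxA mulmxV ?mul1mx.
rewrite mulmx_block [RHS]scalar_mx_block; congr block_mx.
- rewrite mul1mx -scalemxAr rxE -[in LHS](scalemx1 _ s^-1) -[(1 - s)%:M]scalemx1.
  rewrite scalerA -scalerDl -[RHS]scalemx1; congr (_ *: _).
  by field.
- rewrite mul1mx mulmxDr -scalemxAr mulmxA rxE mul_scalar_mx scalerA.
  rewrite -[X in _ + (X + _)]scale1r -!scalerDl.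
  rewrite (_ : _ + _ = 0) ?scale0r //; by field.
- rewrite mul_mx_scalar -scalemxAr TxE scaleNr; exact: subrr.
- rewrite mulmxDr (mulmxV Tu) -!scalemxAr [T *m _]mulmxA TxE scaleNr.
  by rewrite addrCA addNr addr0.
Qed.

Section BlockNorm.
Variables (R : realType) (N : nat).
Variables (a : 'M[R]_1) (b : 'rV[R]_N) (d : 'cV[R]_N) (e : 'M[R]_N).
Let A : 'M[R]_N.+1 := block_mx a b d e.

Let ord0_lshift : (ord0 : 'I_N.+1) = lshift N (0 : 'I_1).
Proof. exact: val_inj. Qed.

Let A_ul : A ord0 ord0 = a 0 0.
Proof. by rewrite ord0_lshift; apply: block_mxEul. Qed.

Let A_ur j : A ord0 (lift ord0 j) = b 0 j.
Proof. by rewrite -rshift1 ord0_lshift; apply: block_mxEur. Qed.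

Let A_dl i : A (lift ord0 i) ord0 = d i 0.
Proof. by rewrite -rshift1 ord0_lshift; apply: block_mxEdl. Qed.

Let A_dr i j : A (lift ord0 i) (lift ord0 j) = e i j.
Proof. by rewrite -!rshift1; apply: block_mxEdr. Qed.

Lemma sum_neq_ord0 (F : 'I_N.+1 -> R) :
  \sum_(j < N.+1 | j != ord0) F j = \sum_(i < N) F (lift ord0 i).
Proof. by rewrite big_mkcond big_ord_recl eqxx /= add0r. Qed.

Lemma l1norm_col_block : l1norm (col ord0 A) = `|a 0 0| + 2 * \sum_i `|d i 0|.
Proof.
rewrite /l1norm sum_neq_ord0 mxE A_ul.
by under eq_bigr do rewrite mxE A_dl.
Qed.

Lemma Bl1norm_block_le K :
  0 <= K -> `|a 0 0| + 2 * \sum_i `|d i 0| <= K ->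
  (forall n, 2^-1 * `|b 0 n| + \sum_i `|e i n| <= K) ->
  Bl1norm A <= K.
Proof.
move=> K0 Kfst Kn; rewrite /Bl1norm ge_max sum_neq_ord0 A_ul.
under eq_bigr do rewrite A_dl.
rewrite Kfst; apply: bigmax_le => // n.
case: (unliftP ord0 n) => [j ->|-> //] _.
rewrite sum_neq_ord0 A_ur.
by under eq_bigr do rewrite A_dr.
Qed.

End BlockNorm.

(** * Norms of the inverse under a sign-matched border *)

(** The hypothesis on the Schur complement says that r x takes the most negative
    value that entries of modulus at most 2 allow.  It makes s the weighted norm
    of the vector (1, -x), which is the direction of the first column of the
    inverse and of the rank-one correction in its other columns, so division
    by s normalizes that direction. *)
Section Bordered.
Variables (R : realType) (N : nat) (r : 'rV[R]_N) (c : 'cV[R]_N) (T : 'M[R]_N).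
Let x := invmx T *m c.
Let s := 1 - (r *m x) 0 0.
Hypothesis Tu : T \in unitmx.
Hypothesis r_le2 : forall j, `|r 0 j| <= 2.
Hypothesis schurE : s = 1 + 2 * \sum_i `|x i 0|.

Let s_gt0 : 0 < s.
Proof. by rewrite schurE ltr_wpDr // mulr_ge0 // sumr_ge0. Qed.

Let s_neq0 : s != 0. Proof. exact: lt0r_neq0. Qed.

Let normVs : `|s^-1| = s^-1.
Proof. by rewrite ger0_norm // invr_ge0 ltW. Qed.

Let first_column :
  `|(s^-1%:M : 'M_1) 0 0| + 2 * \sum_i `|(- s^-1 *: x) i 0| = 1.
Proof.
under eq_bigr do rewrite mxE normrM normrN normVs.
rewrite mxE eqxx mulr1n normVs -mulr_sumr mulrCA -[X in X + _]mulr1.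
by rewrite -mulrDr -schurE mulVf.
Qed.

Lemma l1norm_invmx_bordered :
  l1norm (col ord0 (invmx (block_mx (1%:M : 'M_1) r c T) : 'M_N.+1)) = 1.
Proof. by rewrite (invmx_bordered Tu s_neq0) l1norm_col_block first_column. Qed.

(** With p = r y for a column y of T^-1, the correction -(p / s) (1, -x) has
    weighted norm |p| / 2 after the factor 1/2 of the column norm, and
    |p| <= 2 sum |y_i|: hence the factor 2 in front of K. *)
Lemma Bl1norm_invmx_bordered (K : R) :
  (forall n, \sum_i `|invmx T i n| <= K) ->
  Bl1norm (invmx (block_mx (1%:M : 'M_1) r c T)) <= Num.max (2 * K) 1.
Proof.
move=> colK; rewrite (invmx_bordered Tu s_neq0).
apply: Bl1norm_block_le; first by rewrite le_max ler01 orbT.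
  by rewrite first_column le_max lexx orbT.
move=> n; rewrite le_max; apply/orP; left.
set p := (r *m invmx T) 0 n.
have p_le : `|p| <= 2 * \sum_i `|invmx T i n|.
  rewrite /p mxE mulr_sumr; apply: le_trans (ler_norm_sum _ _ _) _.
  by apply: ler_sum => j _; rewrite normrM ler_wpM2r.
have entry i : `|(invmx T + s^-1 *: (x *m (r *m invmx T))) i n|
    <= `|invmx T i n| + s^-1 * `|p| * `|x i 0|.
  rewrite mxE [X in _ + X]mxE [X in _ + _ * X]mxE big_ord1 -/p.
  apply: le_trans (ler_normD _ _) _.
  by rewrite !normrM normVs mulrAC mulrA.
have sum_le : \sum_i `|(invmx T + s^-1 *: (x *m (r *m invmx T))) i n|
    <= \sum_i `|invmx T i n| + s^-1 * `|p| * ((s - 1) / 2).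
  apply: le_trans (ler_sum _ (fun i _ => entry i)) _.
  rewrite big_split -mulr_sumr schurE /= le_eqVlt; apply/orP; left; apply/eqP.
  by congr (_ + _ * _); field.
rewrite mxE normrM normrN normVs -/p.
apply: le_trans (lerD (lexx _) sum_le) _.
have halve (t u q : R) : t != 0 ->
    2^-1 * (t^-1 * q) + (u + t^-1 * q * ((t - 1) / 2)) = u + q / 2.
  by move=> t0; field.
rewrite halve //.
have := colK n; lra.
Qed.

End Bordered.

(** * The tridiagonal matrix *)

Section Tridiagonal.
Variables (R : realType) (mu : R) (N : nat).
Local Notation T := (Tmx mu N).

(** Conjugation by the alternating signs flips the sign of every entry next to
    the diagonal, which is also the effect of transposition. *)
Lemma Tmx_sign_tr i j : T i j = (-1) ^+ i * T j i * (-1) ^+ j.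
Proof.
have sign2 (a : R) k : (-1) ^+ k * a * (-1) ^+ k = a.
  by rewrite mulrAC -expr2 sqrr_sign mul1r.
rewrite !mxE; have [->|_] := eqVneq i j; first by rewrite sign2.
have [ij|_] := eqVneq i.+1 j.
  by rewrite -ij [i.+2 == _]gtn_eqF // exprS mulN1r mulrN sign2.
have [->|_] := eqVneq (i : nat) j.+1.
  by rewrite exprS mulN1r !mulNr sign2 opprK.
by rewrite mulr0 mul0r.
Qed.

(** The off-diagonal part is antisymmetric, so it drops out of v T v^T, which
    leaves the positive diagonal form. *)
Lemma Tmx_unit : T \in unitmx.
Proof.
rewrite -row_free_unit; apply: inj_row_free => v vT0.
pose D := diag_mx (\row_(j < N) (4 * j.+1%:R)) : 'M[R]_N.
have DE : T + T^T = D.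
  apply/matrixP => i j; rewrite !mxE.
  have [->|_] := eqVneq i j; first by rewrite mulr1n; ring.
  rewrite mulr0n.
  have [ij|_] := eqVneq i.+1 j; last by rewrite eq_sym; case: ifP => _; ring.
  by rewrite -ij [i.+2 == _]gtn_eqF //; ring.
have vDv : (v *m D *m v^T) 0 0 = 0.
  rewrite -DE mulmxDr vT0 add0r -mulmxA -trmx_mul vT0 trmx0 mulmx0 mxE.
  by [].
have nonneg (j : 'I_N) : true -> 0 <= 4 * j.+1%:R * v 0 j ^+ 2.
  by move=> _; rewrite mulr_ge0 ?sqr_ge0 // mulr_ge0.
move: vDv; rewrite mul_mx_diag mxE.
under eq_bigr do rewrite !mxE mulrAC -expr2 mulrC.
move/(psumr_eq0P (fun i => nonneg i)) => v0.
apply/rowP => j; rewrite mxE; apply/eqP.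
by have /eqP := v0 j isT; rewrite mulf_eq0 mulf_eq0 !pnatr_eq0 sqrf_eq0.
Qed.

(** The sign conjugation passes to the inverse, where it is invisible to
    absolute values.  This is what exchanges row sums and column sums. *)
Lemma norm_invTmx_sym i j : `|invmx T i j| = `|invmx T j i|.
Proof.
pose J := diag_mx (\row_(k < N) (-1) ^+ k) : 'M[R]_N.
have JJ : J *m J = 1%:M.
  apply/matrixP => k l; rewrite mul_diag_mx !mxE.
  by case: eqP => [->|_]; rewrite ?mulr0n ?mulr0 // -expr2 sqrr_sign.
have TJ : T = J *m T^T *m J.
  apply/matrixP => k l.
  rewrite Tmx_sign_tr mul_mx_diag [RHS]mxE mul_diag_mx [X in _ = X * _]mxE.
  by rewrite [X in _ = X * _ * _]mxE [X in _ = _ * X * _]mxE [X in _ = _ * X]mxE.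
have Ttu : T^T \in unitmx by rewrite unitmx_tr Tmx_unit.
have inv : J *m (invmx T)^T *m J = invmx T.
  rewrite -[LHS](mulKmx Tmx_unit) {2}TJ trmx_inv !mulmxA.
  by rewrite -[_ *m J *m J]mulmxA JJ mulmx1 -[_ *m T^T *m _]mulmxA
    (mulmxV Ttu) mulmx1 -mulmxA JJ mulmx1.
rewrite -{1}inv mul_mx_diag mxE mul_diag_mx !mxE !normrM !normrX normrN1.
by rewrite !expr1n mul1r mulr1.
Qed.

Lemma mxnorm1_invTmx_col n : \sum_i `|invmx T i n| <= mxnorm1 (invmx T).
Proof.
under eq_bigr do rewrite norm_invTmx_sym.
exact: (le_bigmax 0 (fun i => \sum_j `|invmx T i j|) n).
Qed.

(** * Sign pattern of the solution of T x = mu e_1 *)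

(** Padding with zeros past the end gives the last row the same three-term
    form as the interior ones. *)
Definition pad (x : 'cV[R]_N) (k : nat) : R :=
  if insub k is Some i then x i 0 else 0.

Lemma pad_ord x (i : 'I_N) : pad x i = x i 0.
Proof. by rewrite /pad valK. Qed.

Lemma pad_out x k : (N <= k)%N -> pad x k = 0.
Proof. by move=> Nk; rewrite /pad insubF // ltnNge Nk. Qed.

Lemma sum_pad (a : R) (x : 'cV[R]_N) (k : nat) :
  \sum_(j < N) (if k == j :> nat then a * x j 0 else 0) = a * pad x k.
Proof.
have [kN|Nk] := ltnP k N.
  rewrite -big_mkcond (big_pred1 (Ordinal kN)) /=.
    by rewrite (pad_ord x (Ordinal kN)).
  by move=> j; rewrite /= eq_sym.
rewrite pad_out // mulr0 big1 // => j _.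
by rewrite gtn_eqF // (leq_trans _ Nk).
Qed.

Lemma Tmx_mulE x (i : 'I_N) :
  (T *m x) i 0 = 2 * i.+1%:R * pad x i - mu * pad x i.+1
                 + (if i : nat is k.+1 then mu * pad x k else 0).
Proof.
have -> : (if i : nat is k.+1 then mu * pad x k else 0) =
    \sum_(j < N) (if i == j.+1 :> nat then mu * x j 0 else 0).
  case: (i : nat) => [|k]; first by rewrite big1.
  by rewrite -sum_pad; apply: eq_bigr => j _; rewrite eqSS.
rewrite -mulNr -!sum_pad -!big_split mxE; apply: eq_bigr => j _ /=.
rewrite mxE -val_eqE /=.
have [->|_] := eqVneq (i : nat) j.
  by rewrite gtn_eqF // ltn_eqF // !addr0.
have [<-|_] := eqVneq i.+1 j; first by rewrite ltn_eqF // add0r addr0.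
by rewrite add0r add0r; case: ifP => // _; rewrite mul0r.
Qed.

End Tridiagonal.

(** Read from the end, each term is a nonnegative combination of the two that
    follow it, so nonnegativity of the last term spreads to all of them. *)
Lemma backward_recurrence_ge0 (R : realType) (mu : R) (N : nat) (w : nat -> R) :
  0 < mu -> (forall k, (N <= k)%N -> w k = 0) ->
  (forall k, (k.+1 < N)%N ->
     mu * w k = 2 * k.+2%:R * w k.+1 + mu * w k.+2) ->
  0 <= w N.-1 -> forall k, 0 <= w k.
Proof.
move=> mu0 wout wrec wlast.
have main m k : (N <= (k + m).+1)%N -> 0 <= w k.
  elim: m k => [|m IH] k Nkm.
    have [Nk|kN] := leqP N k; first by rewrite wout.
    by rewrite (_ : k = N.-1) //; lia.
  have [Nk|kN] := leqP N k.+1; first by apply: (IH k); lia.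
  rewrite -(pmulr_rge0 _ mu0) wrec // addr_ge0 // mulr_ge0 ?(ltW mu0) //.
  - by rewrite mulr_ge0.
  - by apply: IH; lia.
  - by apply: IH; lia.
by move=> k; apply: (main N); lia.
Qed.

Definition border_col (R : realType) (mu : R) (N : nat) : 'cV[R]_N :=
  \col_(i < N) (if i == 0 :> nat then mu else 0).

(** This sign pattern makes every term of r x equal to -2 |x_j|, which gives the
    value of the Schur complement. *)
Lemma Tmx_solution_alternates (R : realType) (mu : R) (N : nat) (x : 'cV[R]_N) :
  0 < mu -> Tmx mu N *m x = border_col mu N ->
  forall i, `|x i 0| = (-1) ^+ i * x i 0.
Proof.
move=> mu0 Tx i.
pose w k := (-1) ^+ k * pad x k.
have wout k : (N <= k)%N -> w k = 0 by move=> Nk; rewrite /w pad_out ?mulr0.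
have wrec k : (k.+1 < N)%N -> mu * w k = 2 * k.+2%:R * w k.+1 + mu * w k.+2.
  move=> kN; have := congr1 (fun v : 'cV_N => v (Ordinal kN) 0) Tx.
  (* Multiplying the row equation by (-1)^k turns x into w. *)
  rewrite Tmx_mulE mxE /= /w !exprS => /(congr1 ( *%R ((-1) ^+ k))).
  by rewrite mulr0 => E; apply/eqP; rewrite -subr_eq0 -E; apply/eqP; ring.
have N0 : (0 < N)%N by case: (i) => k; case: (N).
have wfst : 2 * w 0 + mu * w 1 = mu.
  have := congr1 (fun v : 'cV_N => v (Ordinal N0) 0) Tx.
  by rewrite Tmx_mulE mxE /= /w expr0 expr1 => E; rewrite -[RHS]E; ring.
have w_ge0 : forall k, 0 <= w k.
  have [wl|wl] := leP 0 (w N.-1); first exact: backward_recurrence_ge0 wrec wl.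
  (* If the last term is negative, the same recurrence makes - w nonnegative,
     against the first row. *)
  have nw k : 0 <= - w k.
    apply: (@backward_recurrence_ge0 _ mu N (fun k => - w k)) => //.
    - by move=> m Nm; rewrite wout ?oppr0.
    - by move=> m /wrec E; rewrite !mulrN E; ring.
    - by rewrite oppr_ge0 ltW.
  by have := nw 0; have := mulr_ge0 (ltW mu0) (nw 1); lra.
rewrite -[RHS]ger0_norm; last by rewrite -pad_ord; exact: w_ge0.
by rewrite normrM normrX normrN1 expr1n mul1r.
Qed.

Unset Implicit Arguments.
Set Strict Implicit.

Theorem theorem3p26 (R : realType) (mu : R) (hmu : 0 < mu)
    (N : nat) (hN : (0 < N)%N) :
  Bl1norm (invmx (Lmx mu N)) <= Num.max (2 * mxnorm1 (invmx (Tmx mu N))) 1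
  /\ l1norm (col ord0 (invmx (Lmx mu N))) = 1.
Proof.
have Tu : Tmx mu N \in unitmx := Tmx_unit mu N.
pose r := \row_(j < N) (2 * (-1) ^+ j.+1) : 'rV[R]_N.
have r_le2 j : `|r 0 j| <= 2.
  by rewrite mxE normrM normrX normrN1 expr1n mulr1 ger0_norm.
pose x := invmx (Tmx mu N) *m border_col mu N.
have schurE : 1 - (r *m x) 0 0 = 1 + 2 * \sum_i `|x i 0|.
  congr (_ + _); rewrite mxE mulr_sumr -sumrN; apply: eq_bigr => j _.
  rewrite (@Tmx_solution_alternates _ _ _ x hmu) ?mulKVmx //.
  by rewrite mxE exprS; ring.
split; last exact: l1norm_invmx_bordered schurE.
exact: (Bl1norm_invmx_bordered Tu r_le2 schurE (@mxnorm1_invTmx_col _ mu N)).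
Qed.
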